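(* Let $\mathcal{H}_1$ and $\mathcal{H}_2$ be (finite) hypergraphs with no isolated vertices such that their weighted nerves are isomorphic as weighted simplicial complexes, $\mathrm{Nrv}_w(\mathcal{H}_1)\cong \mathrm{Nrv}_w(\mathcal{H}_2)$. Then $\mathcal{H}_1\cong\mathcal{H}_2$.
   Context: A hypergraph $\mathcal{H}=(V,E,\epsilon)$ consists of a finite set $V$ of vertices, a finite set $E$ of hyperedges, and a function $\epsilon:E\to 2^V$. Multi-edges ($\epsilon(e)=\epsilon(e')$ with $e\ne e'$) and empty edges ($\epsilon(e)=\emptyset$) are allowed. One writes $e$ for $\epsilon(e)$ when treating a hyperedge as a set of vertices. A vertex is isolated if it lies in no hyperedge. Two hypergraphs are isomorphic if there are bijections $f_V:V_1\to V_2$ and $f_E:E_1\to E_2$ with $\epsilon_2(f_E(e))=f_V(\epsilon_1(e))$ (image of the set $\epsilon_1(e)$ under $f_V$) for all $e\in E_1$. An (abstract) simplicial complex on a base set $X$ is a collection of nonempty subsets (simplices) of $X$ closed under taking nonempty subsets. A weighted simplicial complex $(K,w)$ is a simplicial complex $K$ with a function $w:K\to\mathbb{R}$. The nerve $\mathrm{Nrv}(\mathcal{H})$ is the simplicial complex on the base set $E$ in which a nonempty $\sigma\subseteq E$ is a simplex whenever $\bigcap_{e\in\sigma}e\neq\emptyset$. The weighted nerve $\mathrm{Nrv}_w(\mathcal{H})$ is the nerve weighted by $w(\sigma)=\left|\bigcap_{e\in\sigma}e\right|$. Distinct copies of a multi-edge are distinct vertices of the weighted nerve, and each empty edge is represented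 in it as an isolated vertex of weight $0$ (i.e. $\{e\}$ is a simplex of weight $0$ contained in no larger simplex). Weighted simplicial complexes $(K_1,w_1)$ on $X_1$ and $(K_2,w_2)$ on $X_2$ are isomorphic if there is a bijection $\phi:X_1\to X_2$ that, together with its inverse, takes simplices to simplices, and satisfies $w_2(\{\phi(v):v\in\sigma\})=w_1(\sigma)$ for every $\sigma\in K_1$. *)

(* Defs.v *)
From mathcomp Require Import all_boot all_order all_algebra.
From mathcomp Require Import reals.

Set Implicit Arguments.
Unset Strict Implicit.
Unset Printing Implicit Defensive.

Import GRing.Theory.
Local Open Scope ring_scope.

(* [incidence] need not be injective (multi-edges) nor nonempty-valued. *)
Record hypergraph := Hypergraph {
  vertex : finType;
  edge : finType;
  incidence : edge -> {set vertex}
}.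

Definition isolated (H : hypergraph) (v : vertex H) : Prop :=
  forall e : edge H, v \notin incidence e.

Definition hypergraph_iso (H1 H2 : hypergraph) : Prop :=
  exists (fV : vertex H1 -> vertex H2) (fE : edge H1 -> edge H2),
    [/\ bijective fV, bijective fE
      & forall e : edge H1, incidence (fE e) = fV @: incidence e].

(* Not every singleton of the base set is required to be a simplex. *)
Record simplicial_complex (X : finType) := SimplicialComplex {
  simplices : {set {set X}};
  simplices_neq0 : forall s, s \in simplices -> s != set0;
  simplices_closed : forall s t : {set X}, s \in simplices -> t \subset s -> t != set0 ->
    t \in simplices
}.

Record weighted_complex (R : realType) (X : finType) := WeightedComplex {
  wcomplex :> simplicial_complex X;
  weight : {s : {set X} | s \in simplices wcomplex} -> R
}.

(* In the last clause the image of a simplex [s1] is given as a simplex [s2]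
   with [val s2 = phi @: val s1]; it exists by the third clause. *)
Definition weighted_complex_iso (R : realType) (X1 X2 : finType)
    (K1 : weighted_complex R X1) (K2 : weighted_complex R X2) : Prop :=
  exists (phi : X1 -> X2) (psi : X2 -> X1),
    [/\ cancel phi psi,
        cancel psi phi,
        forall s : {set X1}, s \in simplices K1 -> phi @: s \in simplices K2,
        forall s : {set X2}, s \in simplices K2 -> psi @: s \in simplices K1
      & forall (s1 : {s : {set X1} | s \in simplices K1}) (s2 : {s : {set X2} | s \in simplices K2}),
          val s2 = phi @: val s1 -> weight s2 = weight s1].

Section Nerve.
Variable H : hypergraph.

(* For [s = set0] this is the full vertex set; it is only used for nonempty
   [s]. *)
Definition common (s : {set edge H}) : {set vertex H} :=
  \bigcap_(e in s) incidence e.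

Lemma common_subset (s t : {set edge H}) :
  t \subset s -> common s \subset common t.
Proof.
move=> ts; apply/bigcapsP => e et; apply: bigcap_inf.
exact: (subsetP ts).
Qed.

Definition nerve_simplices : {set {set edge H}} :=
  [set s | (s != set0) && (common s != set0)].

Fact nerve_simplices_neq0 s : s \in nerve_simplices -> s != set0.
Proof. by rewrite inE => /andP[]. Qed.

Fact nerve_simplices_closed (s t : {set edge H}) :
  s \in nerve_simplices -> t \subset s -> t != set0 -> t \in nerve_simplices.
Proof.
rewrite !inE => /andP[_ cs] ts -> /=.
by apply: contraNneq cs => ct; rewrite -subset0 -ct common_subset.
Qed.

Definition nerve : simplicial_complex (edge H) :=
  SimplicialComplex nerve_simplices_neq0 nerve_simplices_closed.

(* The weighted nerve is carried by the nerve together with one isolated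
   vertex [[set e]] for each empty edge [e], which the nerve omits; the weight
   formula below gives these vertices weight 0. *)
Definition wnerve_simplices : {set {set edge H}} :=
  simplices nerve :|: [set [set e] | e in [set e | incidence e == set0]].

Fact wnerve_simplices_neq0 s : s \in wnerve_simplices -> s != set0.
Proof.
case/setUP => [/simplices_neq0 //|/imsetP[e _ ->]].
by apply/set0Pn; exists e; rewrite inE.
Qed.

Fact wnerve_simplices_closed (s t : {set edge H}) :
  s \in wnerve_simplices -> t \subset s -> t != set0 -> t \in wnerve_simplices.
Proof.
case/setUP => [sK ts t0|sE].
  by apply/setUP; left; apply: simplices_closed sK ts t0.
have [e _ def_s] := imsetP sE.
rewrite def_s subset1 => /orP[/eqP-> _|->//].
by apply/setUP; right; rewrite -def_s.
Qed.

Definition wnerve_complex : simplicial_complex (edge H) :=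
  SimplicialComplex wnerve_simplices_neq0 wnerve_simplices_closed.

Definition weighted_nerve (R : realType) : weighted_complex R (edge H) :=
  @WeightedComplex R (edge H) wnerve_complex
    (fun s => #|common (val s)|%:R).

End Nerve.

(* Main.v *)
Require Import Defs.
From mathcomp Require Import all_boot all_order all_algebra.
From mathcomp Require Import reals.

(* A hypergraph without isolated vertices is determined by its edge set and the
   number of vertices [v] having each nonempty edge set [s] as star. The nerve
   weight of [s] counts the vertices whose star contains [s], so these numbers
   are recovered by downward induction on [s] (Moebius inversion). Equality of
   the fibre sizes of the star maps then gives the vertex bijection. *)

Set Implicit Arguments.
Unset Strict Implicit.
Unset Printing Implicit Defensive.

Lemma card_preim_fibres (V T : finType) (f : V -> T) (P : pred T) :
  #|[set v | P (f v)]| = \sum_(t | P t) #|[set v | f v == t]|.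
Proof.
rewrite -sum1_card (partition_big f P) /=; last by move=> v; rewrite inE.
apply: eq_bigr => t Pt; rewrite -sum1_card; apply: eq_bigl => v.
by rewrite !inE; case: eqP => [->|]; rewrite ?Pt ?andbF.
Qed.

(** Enumerate each fibre: [g] sends the i-th element of a fibre of [f1] to the i-th element of the
    fibre of [f2] over the same point. *)
Lemma eq_card_fibres_bij (V1 V2 T : finType) (f1 : V1 -> T) (f2 : V2 -> T) :
    (forall t, #|[set v | f1 v == t]| = #|[set v | f2 v == t]|) ->
  exists2 g : V1 -> V2, bijective g & f2 \o g =1 f1.
Proof.
move=> eq12.
pose A t := enum [set v | f1 v == t]; pose B t := enum [set w | f2 w == t].
have AB t : size (A t) = size (B t) by rewrite -!cardE.
have memA v : v \in A (f1 v) by rewrite mem_enum inE.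
have exB v : exists w, w \in B (f1 v).
  have: 0 < size (B (f1 v)) by rewrite -AB; case: (A _) (memA v).
  by case: (B _) => // w s _; exists w; rewrite mem_head.
(* Only a default for [nth]: the index used is in range by [ltB]. *)
pose x0 v := xchoose (exB v).
pose g v := nth (x0 v) (B (f1 v)) (index v (A (f1 v))).
have ltB v : index v (A (f1 v)) < size (B (f1 v)) by rewrite -AB index_mem.
have gK v : f2 (g v) = f1 v.
  by have := mem_nth (x0 v) (ltB v); rewrite mem_enum inE => /eqP.
(* Injectivity suffices, as [V1] and [V2] both have the sum of the common fibre sizes as
   cardinality. *)
exists g => //; apply: inj_card_bij => [v v' eq_g|].
  have eq_f : f1 v = f1 v' by rewrite -!gK eq_g.
  have ltB' : index v' (A (f1 v)) < size (B (f1 v)) by rewrite eq_f.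
  move: eq_g; rewrite /g -eq_f (set_nth_default (x0 v) _ ltB').
  move/eqP; rewrite nth_uniq ?enum_uniq // => /eqP eq_i.
  rewrite -(nth_index v (memA v)) eq_i nth_index //.
  by rewrite eq_f.
have cardT (V : finType) (f : V -> T) : #|V| = \sum_t #|[set v | f v == t]|.
  by rewrite -(card_preim_fibres f xpredT) -cardsT.
by rewrite (cardT _ f1) (cardT _ f2) (eq_bigr _ (fun t _ => eq12 t)).
Qed.

Lemma eq_card_supset_fibres (V1 V2 E : finType)
    (f1 : V1 -> {set E}) (f2 : V2 -> {set E}) :
    (forall s, s != set0 ->
       #|[set v | s \subset f1 v]| = #|[set v | s \subset f2 v]|) ->
  forall s, s != set0 -> #|[set v | f1 v == s]| = #|[set v | f2 v == s]|.
Proof.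
move=> eq12 s; have [n] := ubnP (#|E| - #|s|).
elim: n s => // n IHn s le_n s0.
have:= eq12 s s0.
rewrite (card_preim_fibres f1 (fun t => s \subset t)).
rewrite (card_preim_fibres f2 (fun t => s \subset t)).
(* Split off the term [t = s]; the others range over proper supersets of [s], where the induction
   hypothesis applies, and cancel. *)
rewrite (bigD1 s) //= [RHS](bigD1 s) //=.
rewrite (eq_bigr (fun t => #|[set v | f2 v == t]|)) => [/addIn //|t].
rewrite andbC eq_sym -properEneq => st; apply: IHn.
  rewrite ltnS in le_n; apply: leq_trans le_n.
  apply: ltn_sub2l (proper_card st).
  exact: leq_trans (proper_card st) (max_card _).
by rewrite -card_gt0 (leq_trans _ (proper_card st)).
Qed.

Definition star (H : hypergraph) (v : vertex H) : {set edge H} :=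
  [set e | v \in incidence e].

Lemma commonE (H : hypergraph) (s : {set edge H}) :
  common s = [set v | s \subset star v].
Proof.
apply/setP=> v; rewrite inE; apply/bigcapP/subsetP => sv e es.
  by rewrite inE sv.
by have := sv e es; rewrite inE.
Qed.

Lemma star_neq0 (H : hypergraph) (v : vertex H) : ~ isolated v -> star v != set0.
Proof.
apply: contra_notN => /eqP sv e; apply/negP => ve.
by have := in_set0 e; rewrite -sv inE ve.
Qed.

Lemma common_notin_wnerve (H : hypergraph) (s : {set edge H}) :
  s != set0 -> s \notin wnerve_simplices H -> common s = set0.
Proof. by move=> s0; rewrite !inE s0 /= negb_or negbK => /andP[/eqP]. Qed.

(** On simplices this is preservation of weights. A nonempty non-simplex has no weight, but its
    image is again a non-simplex, so both intersections are empty. *)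
Lemma weighted_nerve_iso_card_common (R : realType) (H1 H2 : hypergraph) :
    weighted_complex_iso (weighted_nerve H1 R) (weighted_nerve H2 R) ->
  exists2 phi : edge H1 -> edge H2, bijective phi &
    forall s, s != set0 -> #|common (phi @: s)| = #|common s|.
Proof.
case=> phi [psi [phiK psiK phiS psiS wE]]; exists phi; first by exists psi.
move=> s s0; have [sK|sK] := boolP (s \in wnerve_simplices H1).
  apply/eqP; rewrite -(Num.Theory.eqr_nat R); apply/eqP.
  pose K1 := simplices (weighted_nerve H1 R).
  pose K2 := simplices (weighted_nerve H2 R).
  exact: (wE (exist (fun s => s \in K1) s sK)
             (exist (fun s => s \in K2) (phi @: s) (phiS s sK)) erefl).
have psi_phi : psi @: (phi @: s) = s.
  by rewrite -imset_comp (eq_imset _ (g := id) phiK) imset_id.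
rewrite (common_notin_wnerve s0 sK) common_notin_wnerve ?cards0 //.
  by rewrite imset_eq0.
by apply: contra sK => /psiS; rewrite psi_phi.
Qed.

Theorem proposition37 (R : realType) (H1 H2 : hypergraph)
    (no_isolated1 : forall v : vertex H1, ~ isolated v)
    (no_isolated2 : forall v : vertex H2, ~ isolated v)
    (nerve_iso : weighted_complex_iso (weighted_nerve H1 R)
                                      (weighted_nerve H2 R)) :
  hypergraph_iso H1 H2.
Proof.
have [phi phi_bij card_phi] := weighted_nerve_iso_card_common nerve_iso.
(* Pulling stars back along [phi] gives both star maps the codomain [{set edge H1}]. *)
pose star2 w := phi @^-1: @star H2 w.
have star2_neq0 w : star2 w != set0.
  have [psi _ psiK] := phi_bij.
  have /set0Pn[e we] := star_neq0 (no_isolated2 w).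
  by apply/set0Pn; exists (psi e); rewrite inE psiK.
have eq_fibres s : #|[set v | @star H1 v == s]| = #|[set w | star2 w == s]|.
  (* The weights say nothing about the fibre over [set0]; it is empty on both sides because no
     vertex is isolated. *)
  have [->|] := eqVneq s set0.
    rewrite !eq_card0 // => [w|v]; rewrite inE; apply: negPf => //.
    exact: star_neq0.
  apply: eq_card_supset_fibres => {}s s0.
  rewrite -commonE -card_phi // commonE; congr #|pred_of_set _|.
  by apply/setP=> w; rewrite !inE sub_imset_pre.
have [g g_bij starg] := eq_card_fibres_bij eq_fibres.
exists g, phi; split=> // e; apply/setP=> w.
(* With [w = g (h w)], the claim is that [e] lies in [star2 (g (h w))] exactly when it lies in
   [star (h w)]. *)
have [h gK hK] := g_bij; rewrite -(hK w) mem_imset; last exact: can_inj gK.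
by have /setP/(_ e) := starg (h w); rewrite !inE.
Qed.
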